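(* Let $X$ be an infinite dimensional complex Banach space and $T\in L(X)$. If there exist $n,m\in\mathbb N$ such that $\alpha(T_{[n]})<\infty$ and $\beta(T_{[m]})<\infty$, then $\mathcal R(T^{m_T})$ is closed and $T_{[m_T]}$ is a Fredholm operator (on the Banach space $\mathcal R(T^{m_T})$).
   Context: $L(X)$ is the algebra of bounded linear operators on $X$; $\mathbb N$ contains $0$. For a linear operator $S$, $\mathcal N(S)$ and $\mathcal R(S)$ are its kernel and range, $\alpha(S)=\dim\mathcal N(S)$, and $\beta(S)$ is the codimension of $\mathcal R(S)$ in the space on which $S$ acts. For $n\in\mathbb N$, $T_{[n]}:\mathcal R(T^n)\to\mathcal R(T^n)$ is the restriction of $T$ to $\mathcal R(T^n)$ (which is not assumed closed), with $T_{[0]}=T$. The essential degree of $T$ is $m_T=\inf\{n\in\mathbb N:\min\{\alpha(T_{[n]}),\beta(T_{[n]})\}<\infty\}$. *)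

(* Defs.v *)
From HB Require Import structures.
From mathcomp Require Import all_boot all_order all_algebra.
From mathcomp Require Import all_classical all_reals all_analysis.
Import Order.TTheory GRing.Theory Num.Theory.
Import numFieldNormedType.Exports.

Set Implicit Arguments.
Unset Strict Implicit.
Unset Printing Implicit Defensive.

Local Open Scope classical_set_scope.
Local Open Scope ring_scope.

Section IterLinear.
Context {K : pzRingType} {V : lmodType K}.

Fact iter_is_linear (n : nat) (T : {linear V -> V}) : linear (iter n T).
Proof. by elim: n => [|n IHn] a x y //=; rewrite IHn linearP. Qed.

HB.instance Definition _ (n : nat) (T : {linear V -> V}) :=
  GRing.isLinear.Build K V V _ (iter n T) (iter_is_linear n T).

End IterLinear.

(* The range of a linear map S : V -> W as a type of its own: a linear subspace
   of W which, when W is normed, carries the norm of W and is not assumed to be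
   closed. *)
Section Range.
Context {K : pzRingType} {V W : lmodType K}.

Definition range_pred (S : {linear V -> W}) : {pred W} :=
  fun y => `[< range S y >].

Record range_of (S : {linear V -> W}) := RangeOf {
  rval : W;
  rvalP : rval \in range_pred S }.

Context (S : {linear V -> W}).

HB.instance Definition _ := [isSub for @rval S].
HB.instance Definition _ := [Choice of range_of S by <:].

Fact range_pred_submod_closed : submod_closed (range_pred S).
Proof.
split; first by apply/asboolP; exists 0 => //; exact: linear0.
move=> a _ _ /asboolP[x _ <-] /asboolP[y _ <-].
by apply/asboolP; exists (a *: x + y) => //; exact: linearP.
Qed.

HB.instance Definition _ :=
  GRing.isSubmodClosed.Build K W (range_pred S) range_pred_submod_closed.
HB.instance Definition _ := [SubChoice_isSubLmodule of range_of S by <:].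

End Range.

Section RangeNorm.
Context {K : numFieldType} {V W : normedModType K} (S : {linear V -> W}).

Let norm (x : range_of S) : K := `|rval x|.

Fact range_of_normD x y : norm (x + y) <= norm x + norm y.
Proof. exact: ler_normD. Qed.

Fact range_of_normZ (a : K) x : norm (a *: x) = `|a| * norm x.
Proof. exact: normrZ. Qed.

Fact range_of_norm0_eq0 x : norm x = 0 -> x = 0.
Proof. by move=> /normr0_eq0 x0; exact/val_inj. Qed.

HB.instance Definition _ := Lmodule_isNormed.Build K (range_of S)
  range_of_normD range_of_normZ range_of_norm0_eq0.

End RangeNorm.

(* restr T n is T_[n], the endomorphism of the range of T^n induced by T. *)
Section Restriction.
Context {K : pzRingType} {V : lmodType K} (T : {linear V -> V}) (n : nat).

Fact restr_subproof (y : range_of (iter n T)) :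
  T (rval y) \in range_pred (iter n T).
Proof.
case: y => _ /= /asboolP[x _ <-]; apply/asboolP; exists (T x) => //.
by rewrite -[LHS]iterSr.
Qed.

Definition restr (y : range_of (iter n T)) : range_of (iter n T) :=
  RangeOf (restr_subproof y).

Fact restr_is_linear : linear restr.
Proof. by move=> a x y; apply: val_inj; exact: linearP. Qed.

HB.instance Definition _ :=
  GRing.isLinear.Build K (range_of (iter n T)) (range_of (iter n T)) _
    restr restr_is_linear.

End Restriction.

Arguments restr {K V} T n y.

(* Dimensions are extended natural numbers, represented in \bar R. *)
Section Dimension.
Context (R : realType) {K : numFieldType} {V : lmodType K}.

(* v is linearly independent in V / N. *)
Definition lin_indep_mod (N : set V) (k : nat) (v : 'I_k -> V) : Prop :=
  forall c : 'I_k -> K, N (\sum_(i < k) c i *: v i) -> forall i, c i = 0.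

Definition algdim (M : set V) : \bar R :=
  ereal_sup [set (k%:R)%:E | k in [set k : nat |
    exists v : 'I_k -> V,
      (forall i, M (v i)) /\ lin_indep_mod [set 0] v]].

Definition algcodim (M : set V) : \bar R :=
  ereal_sup [set (k%:R)%:E | k in [set k : nat |
    exists v : 'I_k -> V, lin_indep_mod M v]].

End Dimension.

Section OperatorDimension.
Context (R : realType) {K : numFieldType} {V : lmodType K}.

Definition alpha (S : {linear V -> V}) : \bar R := algdim R [set x | S x = 0].

Definition beta (S : {linear V -> V}) : \bar R := algcodim R (range S).

End OperatorDimension.

(* The infimum is taken in \bar R, so that it is +oo on the empty set. *)
Definition essential_degree (R : realType) {K : numFieldType} {V : lmodType K}
    (T : {linear V -> V}) : \bar R :=
  ereal_inf [set (n%:R)%:E | n in [set n : nat |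
    (Order.min (alpha R (restr T n)) (beta R (restr T n)) < +oo)%E]].

Definition bounded_op {K : numFieldType} {X : normedModType K}
  (T : {linear X -> X}) : Prop := bounded_near T (nbhs (0 : X)).

Definition fredholm (R : realType) {K : numFieldType} {X : normedModType K}
    (S : {linear X -> X}) : Prop :=
  [/\ bounded_op S, closed (range S),
      (alpha R S < +oo)%E & (beta R S < +oo)%E].

(* Main.v *)
Require Import Defs.
From HB Require Import structures.
From mathcomp Require Import all_boot all_order all_algebra.
From mathcomp Require Import complex ring lra.
From mathcomp Require Import all_classical all_reals all_analysis.
Import Order.TTheory GRing.Theory Num.Theory.
Import numFieldNormedType.Exports.

Set Implicit Arguments.
Unset Strict Implicit.
Unset Printing Implicit Defensive.

Local Open Scope classical_set_scope.
Local Open Scope ring_scope.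
Local Open Scope complex_scope.

(** Write R_n for the range of T^n and N_n for the kernel of T restricted to
    R_n, so that the two dimensions in play are alpha_n = dim N_n and
    beta_n = dim R_n / R_{n+1}.

    The algebra. T maps R_n / R_{n+1} onto R_{n+1} / R_{n+2} with kernel
    isomorphic to N_n / N_{n+1}. Hence alpha_n and beta_n decrease with n, and
    beta_n = beta_{n+1} + dim N_n / N_{n+1}. Once some alpha and some beta are
    finite, the finiteness of one of alpha_d, beta_d therefore forces that of
    the other ([fin_alpha_beta]); this applies to the essential degree d, and
    then to d + 1. Iterating, R_d meets the kernel of T^d in a space of finite
    dimension ([fin_range_ker_iter]), and R_d + ker T^d has finite codimension,
    since T^d embeds X / (R_d + ker T^d) in R_d / R_{2d}
    ([fin_codim_range_ker]).

    The analysis. It remains to see that a bounded operator A has closed range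
    as soon as range A meets some closed subspace N in finite dimension and
    range A + N has finite codimension ([closed_range_fin]); here A = T^d and
    N = ker T^d, and the same with d + 1 for the range of the restriction.
    Adding finitely many vectors to N keeps it closed and makes
    range A + N = X. The open mapping theorem for the induced surjection onto
    X / N then lifts every x to some u with |u| <= C |x| and x - A u in N. For
    x in range A the error x - A u lies in the finite-dimensional, hence
    closed, space range A cap N, so that a point of the closure of range A can
    be reached by summing a geometric series of such lifts.

    That summation ([halving_iteration]) also gives the open mapping theorem
    from Baire's theorem, and the closedness of N + <g>. The analysis is done
    over the real numbers, a complex Banach space being seen as a real one. *)

(** * Subspaces and relative dimension *)

Definition submodule {K : pzRingType} {V : lmodType K} (M : set V) : Prop :=
  M 0 /\ forall (a : K) (x y : V), M x -> M y -> M (a *: x + y).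

(** The sum of [Q] and the span of [s]. The recursion on [s] absorbs the vectors
    one at a time, which turns statements about finitely many vectors into
    inductions on a single one. *)
Fixpoint span_mod {K : pzRingType} {V : lmodType K} (Q : set V) (s : seq V)
    : set V :=
  if s is g :: s' then [set x | exists a : K, span_mod Q s' (x - a *: g)]
  else Q.

(** For [Q] inside [P], this says that the quotient [P / Q] has finite dimension.
    The vectors of [s] may lie outside [P]. *)
Definition fin_mod {K : pzRingType} {V : lmodType K} (P Q : set V) : Prop :=
  exists s : seq V, P `<=` span_mod Q s.

Section Subspaces.
Context {K : pzRingType} {V : lmodType K}.
Implicit Types (M N P Q : set V).

Lemma submoduleD M x y : submodule M -> M x -> M y -> M (x + y).
Proof. by move=> [_ h] Mx My; rewrite -[x]scale1r; exact: h. Qed.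

Lemma submoduleZ M (a : K) x : submodule M -> M x -> M (a *: x).
Proof. by move=> [M0 h] Mx; rewrite -[_ *: _]addr0; exact: h. Qed.

Lemma submoduleN M x : submodule M -> M x -> M (- x).
Proof. by move=> sM Mx; rewrite -scaleN1r; exact: submoduleZ. Qed.

Lemma submoduleB M x y : submodule M -> M x -> M y -> M (x - y).
Proof. by move=> sM Mx My; apply: submoduleD => //; exact: submoduleN. Qed.

Lemma submodule_sum M (k : nat) (c : 'I_k -> K) (v : 'I_k -> V) :
  submodule M -> (forall i, M (v i)) -> M (\sum_(i < k) c i *: v i).
Proof.
move=> sM Mv; apply: big_ind => [|x y Mx My|i _]; first exact: sM.1.
- exact: submoduleD.
- exact: submoduleZ.
Qed.

Lemma submodule0 : submodule ([set 0] : set V).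
Proof. by split=> // a x y -> ->; rewrite scaler0 addr0. Qed.

Lemma submoduleI M N : submodule M -> submodule N -> submodule (M `&` N).
Proof.
move=> [M0 hM] [N0 hN]; split=> // a x y [Mx Nx] [My Ny].
by split; [exact: hM | exact: hN].
Qed.

Lemma span_modS P Q s : P `<=` Q -> span_mod P s `<=` span_mod Q s.
Proof.
move=> PQ; elim: s => [//|g s IHs] x [a xP]; exists a; exact: IHs.
Qed.

Lemma sub_span_mod Q s : Q `<=` span_mod Q s.
Proof.
by elim: s => [//|g s IHs] x Qx; exists 0; rewrite scale0r subr0; exact: IHs.
Qed.

Lemma span_mod_cat Q s t : span_mod Q (s ++ t) = span_mod (span_mod Q t) s.
Proof. by elim: s => [//|g s IHs] /=; rewrite IHs. Qed.

Lemma submodule_span_mod Q s : submodule Q -> submodule (span_mod Q s).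
Proof.
move=> sQ; elim: s => [//|g s [s0 sZ]]; split.
  by exists 0; rewrite scale0r subr0.
move=> a x y [b xb] [c yc]; exists (a * b + c).
rewrite scalerDl -scalerA opprD addrACA -scalerBr; exact: sZ.
Qed.

Lemma span_mod_sub Q P s : submodule P -> Q `<=` P -> {in s, forall g, P g} ->
  span_mod Q s `<=` P.
Proof.
move=> sP QP; elim: s => [//|g s IHs] Ps x [a xa].
rewrite -(subrK (a *: g) x); apply: submoduleD => //.
  by apply: IHs => // h hs; apply: Ps; rewrite inE hs orbT.
by apply: submoduleZ => //; apply: Ps; rewrite inE eqxx.
Qed.

Lemma span_mod_codom Q (k : nat) (v : 'I_k -> V) (c : 'I_k -> K) x :
  Q (x - \sum_(i < k) c i *: v i) -> span_mod Q [seq v i | i <- enum 'I_k] x.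
Proof.
rewrite -big_enum; elim: (enum 'I_k) x => [|i s IHs] x.
  by rewrite big_nil subr0.
by rewrite big_cons opprD addrA => /IHs; exists (c i).
Qed.

Lemma span_modE Q s x : span_mod Q s x ->
  exists c : 'I_(size s) -> K, Q (x - \sum_(i < size s) c i *: s`_i).
Proof.
elim: s x => [|g s IHs] x /=.
  by exists (fun=> 0); rewrite big_ord0 subr0.
move=> [a /IHs[c Qc]].
exists (fun i => oapp c a (unlift ord0 i)).
rewrite big_ord_recl unlift_none /= opprD addrA.
rewrite (eq_bigr (fun i : 'I_(size s) => c i *: s`_i)) // => i _.
by rewrite liftK.
Qed.

Lemma fin_mod_trans P Q S : fin_mod P Q -> fin_mod Q S -> fin_mod P S.
Proof.
move=> [s Ps] [t Qt]; exists (s ++ t) => x /Ps.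
by rewrite span_mod_cat; exact: span_modS.
Qed.

Lemma fin_modS P Q P' Q' :
  P `<=` P' -> Q' `<=` Q -> fin_mod P' Q' -> fin_mod P Q.
Proof.
move=> PP' QQ' [s P's]; exists s => x /PP'/P's; exact: span_modS.
Qed.

End Subspaces.

Section LinearMaps.
Context {K : pzRingType} {V W : lmodType K} (f : {linear V -> W}).

Lemma submodule_range : submodule (range f).
Proof.
split; first by exists 0 => //; exact: linear0.
by move=> a _ _ [x _ <-] [y _ <-]; exists (a *: x + y) => //; exact: linearP.
Qed.

Lemma submodule_ker : submodule [set x | f x = 0].
Proof.
split=> [|a x y /= fx fy]; first exact: linear0.
by rewrite linearP fx fy scaler0 addr0.
Qed.

Lemma span_mod_map (Q : set V) (Q' : set W) s x :
  (forall x, Q x -> Q' (f x)) ->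
  span_mod Q s x -> span_mod Q' [seq f g | g <- s] (f x).
Proof.
move=> QQ'; elim: s x => [|g s IHs] x /=; first exact: QQ'.
by move=> [a /IHs]; rewrite linearB linearZ; exists a.
Qed.

Lemma fin_mod_image (P Q : set V) (P' Q' : set W) :
  P' `<=` f @` P -> f @` Q `<=` Q' -> fin_mod P Q -> fin_mod P' Q'.
Proof.
move=> PP' QQ' [s Ps]; exists [seq f g | g <- s] => y /PP' [x /Ps xs <-].
by apply: span_mod_map xs => z Qz; apply: QQ'; exists z.
Qed.

End LinearMaps.

(** The same finiteness expressed by independent families, the form in which
    [algdim] and [algcodim] measure it. It passes to preimages, as [fin_mod]
    passes to images and extensions. *)
Definition bounded_indep {K : numFieldType} {V : lmodType K} (P Q : set V) :=
  exists n : nat, forall (k : nat) (v : 'I_k -> V),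
    (forall i, P (v i)) -> lin_indep_mod Q v -> (k <= n)%N.

Section Dimension.
Context {K : numFieldType}.
Implicit Types V W : lmodType K.

(** Steinitz: k vectors that are combinations of fewer than k vectors modulo [Q]
    have a coefficient matrix with a nonzero row in its left kernel, and this row
    is a relation between them modulo [Q]. *)
Lemma fin_mod_bounded_indep V (P Q : set V) :
  submodule Q -> fin_mod P Q -> bounded_indep P Q.
Proof.
move=> sQ [s Ps]; exists (size s) => k v Pv indep.
have /choice[A QA] : forall i, exists c : 'I_(size s) -> K,
    Q (v i - \sum_(j < size s) c j *: s`_j).
  by move=> i; exact/span_modE/Ps.
rewrite leqNgt; apply/negP => sk.
pose M := \matrix_(i < k, j < size s) A i j.
have /rowV0Pn[u uker /rV0Pn[i ui]] : kermx M != 0.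
  rewrite kermx_eq0; apply/negP => /eqP rM.
  by have := rank_leq_col M; rewrite rM leqNgt sk.
have uM : u *m M = 0 by apply/sub_kermxP.
apply: (negP ui); apply/eqP; apply: (indep (fun i => u 0 i)).
have -> : \sum_i u 0 i *: v i =
    \sum_i u 0 i *: (v i - \sum_(j < size s) A i j *: s`_j).
  rewrite [RHS](eq_bigr _ (fun i _ => scalerBr _ _ _)).
  rewrite sumrB [X in _ - X](_ : _ = 0) ?subr0 //.
  under eq_bigr do rewrite scaler_sumr.
  rewrite exchange_big big1 //= => j _.
  have /rowP/(_ j) := uM; rewrite !mxE => uMj.
  under eq_bigr do rewrite scalerA.
  rewrite -scaler_suml [X in X *: _](_ : _ = 0) ?scale0r // -[RHS]uMj.
  by apply: eq_bigr => l _; rewrite mxE.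
exact: submodule_sum.
Qed.

(** An independent family of maximal length spans. It is taken in [P], so that [P]
    is exactly [span_mod Q s] when [Q] is contained in [P]. *)
Lemma bounded_indep_span V (P Q : set V) :
  submodule Q -> bounded_indep P Q ->
  exists2 s : seq V, {in s, forall g, P g} & P `<=` span_mod Q s.
Proof.
move=> sQ [n bnd].
pose good k :=
  `[< exists v : 'I_k -> V, (forall i, P (v i)) /\ lin_indep_mod Q v >].
have good0 : exists k, good k.
  by exists 0%N; apply/asboolP; exists (fun=> 0); split=> [[]|c _ []].
have goodn k : good k -> (k <= n)%N by move=> /asboolP[v [Pv]]; exact: bnd.
case: (ex_maxnP good0 goodn) => k /asboolP[v [Pv indep]] kmax.
exists [seq v i | i <- enum 'I_k].
  by move=> _ /mapP[i _ ->]; exact: Pv.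
move=> x Px; pose w (i : 'I_k.+1) := oapp v x (unlift ord0 i).
have : ~ lin_indep_mod Q w.
  move=> windep; have /kmax : good k.+1; last by rewrite ltnn.
  by apply/asboolP; exists w; split => // i; rewrite /w;
  case: (unlift ord0 i) => /=.
move=> /existsNP[c /not_implyP[Qc /existsNP[j cj]]].
have wsum : \sum_(i < k.+1) c i *: w i =
    c ord0 *: x + \sum_(i < k) c (lift ord0 i) *: v i.
  rewrite big_ord_recl /w unlift_none /=; congr (_ + _).
  by apply: eq_bigr => i _; rewrite liftK.
have [c0|c0] := eqVneq (c ord0) 0.
  have Qs : Q (\sum_(i < k) c (lift ord0 i) *: v i).
    by move: Qc; rewrite wsum c0 scale0r add0r.
  exfalso; apply: cj; case: (unliftP ord0 j) => [j' ->|-> //].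
  exact: (indep (fun i => c (lift ord0 i))).
apply: (@span_mod_codom _ _ _ _ _ (fun i => - ((c ord0)^-1 * c (lift ord0 i)))).
have -> : x - \sum_(i < k) - ((c ord0)^-1 * c (lift ord0 i)) *: v i =
    (c ord0)^-1 *: \sum_(i < k.+1) c i *: w i.
  rewrite wsum scalerDr scalerA mulVf // scale1r scaler_sumr -sumrN.
  by congr (_ + _); apply: eq_bigr => i _; rewrite scaleNr opprK scalerA.
exact: submoduleZ.
Qed.

Lemma fin_modP V (P Q : set V) :
  submodule Q -> fin_mod P Q <-> bounded_indep P Q.
Proof.
move=> sQ; split; first exact: fin_mod_bounded_indep.
by move=> /(bounded_indep_span sQ)[s _ Ps]; exists s.
Qed.

(** The induced map [P / Q -> P' / Q'] is injective, so that independent families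
    of the source are mapped to independent families of the target. *)
Lemma fin_mod_preimage V W (f : {linear V -> W}) (P Q : set V) (P' Q' : set W) :
  submodule P -> submodule Q -> submodule Q' ->
  (forall x, P x -> P' (f x)) -> (forall x, P x -> Q' (f x) -> Q x) ->
  fin_mod P' Q' -> fin_mod P Q.
Proof.
move=> sP sQ sQ' fP fQ /(fin_modP _ sQ')[n bnd]; apply/(fin_modP _ sQ).
exists n => k v Pv indep; apply: (bnd k (f \o v)) => [i|c Qc]; first exact: fP.
apply: indep; apply: fQ; first exact: submodule_sum.
by rewrite linear_sum; under eq_bigr do rewrite linearZ.
Qed.

End Dimension.

(** * Dimensions attached to the restrictions of an operator *)

Lemma ereal_sup_nat_fin (R : realType) (A : set nat) :
  (ereal_sup [set (k%:R : R)%:E | k in A] < +oo)%E <->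
  exists n, forall k, A k -> (k <= n)%N.
Proof.
split=> [sup_fin|[n An]]; last first.
  apply: (@le_lt_trans _ _ (n%:R)%:E); last exact: ltry.
  by apply: ge_ereal_sup => _ [k Ak <-]; rewrite lee_fin ler_nat An.
have ub k : A k -> ((k%:R)%:E <= ereal_sup [set (k%:R : R)%:E | k in A])%E.
  by move=> Ak; apply: ereal_sup_ubound; exists k.
case: (ereal_sup _) sup_fin ub => [r _|//|_] ub.
- exists (Num.truncn r).+1 => k /ub; rewrite lee_fin => kr.
  by rewrite -(ler_nat R) (le_trans kr) // ltW // truncnS_gt.
- by exists 0%N => k /ub.
Qed.

Section RestrictionDimension.
Context {K : numFieldType} {V : lmodType K} (T : {linear V -> V}).
Implicit Types n : nat.

Definition ker_range n : set V := [set x | T x = 0] `&` range (iter n T).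

Lemma rval_range n (z : range_of (iter n T)) : range (iter n T) (rval z).
Proof. by case: z => y /= /asboolP. Qed.

Lemma rval_sum n (k : nat) (c : 'I_k -> K) (v : 'I_k -> range_of (iter n T)) :
  rval (\sum_(i < k) c i *: v i) = \sum_(i < k) c i *: rval (v i).
Proof.
rewrite -[LHS]/(val _) raddf_sum; apply: eq_bigr => i _.
exact: (GRing.valZ (c i) (v i)).
Qed.

Lemma range_restr n (z : range_of (iter n T)) :
  range (restr T n) z <-> range (iter n.+1 T) (rval z).
Proof.
split=> [[y _ <-]|[x _ xz]].
  by have [x _ /= xy] := rval_range y; exists x; rewrite //= xy.
have nx : iter n T x \in range_pred (iter n T) by apply/asboolP; exists x.
by exists (RangeOf nx) => //; apply: val_inj.
Qed.

(** This transfers dimensions from the type [range_of (iter n T)] to [V], so that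
    the ranges for different n can be compared as subsets of one space. *)
Lemma restr_dimension_fin (R : realType) n (P' Q' : set (range_of (iter n T)))
    (P Q : set V) :
  submodule Q -> P `<=` range (iter n T) ->
  (forall z, P' z <-> P (rval z)) -> (forall z, Q' z <-> Q (rval z)) ->
  (ereal_sup [set (k%:R : R)%:E | k in [set k : nat |
    exists v : 'I_k -> range_of (iter n T),
      (forall i, P' (v i)) /\ lin_indep_mod Q' v]] < +oo)%E <-> fin_mod P Q.
Proof.
move=> sQ Pr PP QQ; rewrite ereal_sup_nat_fin fin_modP //.
split=> -[b hb]; exists b => k.
  move=> v Pv indep; apply: hb.
  have vr i : v i \in range_pred (iter n T) by apply/asboolP/Pr.
  exists (fun i => RangeOf (vr i)); split=> [i|c]; first exact/PP/Pv.
  by rewrite QQ rval_sum /=; exact: indep.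
move=> [v [Pv indep]]; apply: (hb k (fun i => rval (v i))) => [i|c].
  exact/PP.
by rewrite -rval_sum -QQ; exact: indep.
Qed.

Lemma alpha_restr_fin (R : realType) n :
  (alpha R (restr T n) < +oo)%E <-> fin_mod (ker_range n) [set 0].
Proof.
apply: restr_dimension_fin => [|x []//|z|z].
- exact: submodule0.
- split=> [/(congr1 (@rval _ _ _ _))/= Tz|[Tz _]]; last exact: val_inj.
  by split=> //; exact: rval_range.
- by split=> [->//|z0]; exact: val_inj.
Qed.

Lemma beta_restr_fin (R : realType) n :
  (beta R (restr T n) < +oo)%E <->
  fin_mod (range (iter n T)) (range (iter n.+1 T)).
Proof.
rewrite -(@restr_dimension_fin R n setT (range (restr T n))) //; first last.
- exact: range_restr.
- by move=> z; split => // _; exact: rval_range.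
- exact: (submodule_range (iter n.+1 T)).
rewrite /beta /algcodim; set A := [set _ | _ in _]; set B := [set _ | _ in _].
suff -> : A = B by [].
apply/seteqP; split=> _ [k [v] vk <-]; exists k => //; exists v => //.
by case: vk.
Qed.

End RestrictionDimension.

Section Chain.
Context {K : numFieldType} {V : lmodType K} (T : {linear V -> V}).
Implicit Types n : nat.

Notation Rg n := (range (iter n T)).
Notation Kr n := (ker_range T n).
Notation fin_alpha n := (fin_mod (Kr n) [set 0]).
Notation fin_beta n := (fin_mod (Rg n) (Rg n.+1)).

Lemma range_iterS n : Rg n.+1 `<=` Rg n.
Proof. by move=> _ [x _ <-]; exists (T x) => //; rewrite iterSr. Qed.

Lemma submodule_ker_range n : submodule (Kr n).
Proof.
apply: submoduleI; first exact: submodule_ker.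
exact: (submodule_range (iter n T)).
Qed.

Lemma fin_alphaS n : fin_alpha n -> fin_alpha n.+1.
Proof. by apply: fin_modS => // x [Tx /range_iterS]. Qed.

(** [T] induces a surjection from R_n / R_{n+1} onto R_{n+1} / R_{n+2}. *)
Lemma fin_betaS n : fin_beta n -> fin_beta n.+1.
Proof.
apply: (fin_mod_image (f := T)) => [_ [x _ <-]|_ [_ [x _ <-]] <-].
- by exists (iter n T x) => //; exists x.
- by exists x.
Qed.

(** The preimage of R_{n+2} under [T] in R_n is R_{n+1} + N_n. Hence
    R_n / (R_{n+1} + N_n) embeds in R_{n+1} / R_{n+2}, and only the
    finite-dimensional N_n is left to account for. *)
Lemma fin_beta_pred n : fin_alpha n -> fin_beta n.+1 -> fin_beta n.
Proof.
move=> [s Ks] bS.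
have sR m : submodule (Rg m) by exact: (submodule_range (iter m T)).
apply: (@fin_mod_trans _ _ _ (span_mod (Rg n.+1) s)); last by exists s.
apply: (fin_mod_preimage (f := T) _ _ _ _ _ bS) => //.
- exact: submodule_span_mod.
- by move=> _ [x _ <-]; exists x.
- move=> x xn [y _ yx].
  rewrite -(subrK (iter n.+1 T y) x); apply: submoduleD.
  + exact: submodule_span_mod.
  + apply: (@span_modS _ _ [set 0]); first by move=> _ ->; exact: (sR _).1.
    apply: Ks; split; first by rewrite /= linearB /= -yx subrr.
    by apply: submoduleB => //; apply: range_iterS; exists y.
  + by apply: sub_span_mod; exists y.
Qed.

(** As N_{n+1} is the intersection of N_n and R_{n+1}, the quotient N_n / N_{n+1}
    embeds in R_n / R_{n+1}. *)
Lemma fin_alpha_pred n : fin_beta n -> fin_alpha n.+1 -> fin_alpha n.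
Proof.
move=> bn; apply: fin_mod_trans.
apply: (fin_mod_preimage (f := idfun) _ _ _ _ _ bn) => //.
- exact: submodule_ker_range.
- exact: submodule_ker_range.
- exact: (submodule_range (iter n.+1 T)).
- by move=> x [].
- by move=> x [Tx _].
Qed.

Lemma fin_alphaD n k : fin_alpha n -> fin_alpha (n + k)%N.
Proof.
by move=> an; elim: k => [|k IHk]; rewrite ?addn0 // addnS; exact: fin_alphaS.
Qed.

Lemma fin_betaD n k : fin_beta n -> fin_beta (n + k)%N.
Proof.
by move=> an; elim: k => [|k IHk]; rewrite ?addn0 // addnS; exact: fin_betaS.
Qed.

Lemma fin_beta_descend n k : fin_alpha n -> fin_beta (n + k)%N -> fin_beta n.
Proof.
move=> an; elim: k => [|k IHk]; rewrite ?addn0 // addnS => b.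
by apply/IHk/fin_beta_pred => //; exact: fin_alphaD.
Qed.

Lemma fin_alpha_descend n k : fin_beta n -> fin_alpha (n + k)%N -> fin_alpha n.
Proof.
move=> an; elim: k => [|k IHk]; rewrite ?addn0 // addnS => b.
by apply/IHk/fin_alpha_pred => //; exact: fin_betaD.
Qed.

(** If, say, alpha_d is finite, then so is every later alpha, and finiteness of
    beta descends step by step to d from an index beyond both d and m. *)
Lemma fin_alpha_beta (d n m : nat) : fin_alpha n -> fin_beta m ->
  fin_alpha d \/ fin_beta d -> fin_alpha d /\ fin_beta d.
Proof.
move=> an bm [ad|bd]; split=> //.
- by apply: (@fin_beta_descend _ m) => //; rewrite addnC; exact: fin_betaD.
- by apply: (@fin_alpha_descend _ n) => //; rewrite addnC; exact: fin_alphaD.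
Qed.

(** The intersection of R_d with ker T^(k+1) is mapped by [T] into that with
    ker T^k, and the kernel of this map is N_d. *)
Lemma fin_range_ker_iter d k :
  fin_alpha d -> fin_mod (Rg d `&` [set x | iter k T x = 0]) [set 0].
Proof.
move=> ad; elim: k => [|k IHk]; first by exists [::] => x [].
apply: (fin_mod_trans _ ad).
have sRK m : submodule (Rg d `&` [set x | iter m T x = 0]).
  apply: submoduleI; first exact: (submodule_range (iter d T)).
  exact: (submodule_ker (iter m T)).
apply: (fin_mod_preimage (f := T) _ _ _ _ _ IHk) => //.
- exact: submodule_ker_range.
- exact: submodule0.
- move=> x [[y _ <-]]; rewrite /= -iterS iterSr => Tx.
  by split => //; exists (T y); rewrite // -iterSr.
- by move=> x [].
Qed.

Lemma fin_rangeD d k : fin_beta d -> fin_mod (Rg d) (Rg (d + k)%N).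
Proof.
move=> bd; elim: k => [|k IHk]; first by rewrite addn0; exists [::].
by apply: (fin_mod_trans IHk); rewrite addnS; exact: fin_betaD.
Qed.

(** The set on the right is R_d + ker T^d, the preimage under T^d of R_{2d}; so
    its quotient embeds in R_d / R_{2d}. *)
Lemma fin_codim_range_ker d : fin_beta d ->
  fin_mod [set: V] [set x | exists u, iter d T (x - iter d T u) = 0].
Proof.
move=> /(@fin_rangeD d d) bd.
apply: (fin_mod_preimage (f := iter d T) _ _ _ _ _ bd) => //.
- split; first by exists 0; rewrite !(linear0, addr0).
  move=> a x y [u xu] [w yw]; exists (a *: u + w).
  have -> : a *: x + y - iter d T (a *: u + w) =
      a *: (x - iter d T u) + (y - iter d T w).
    by rewrite linearP opprD addrACA scalerBr.
  by rewrite [LHS](linearP (iter d T)) /= xu yw scaler0 addr0.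
- exact: (submodule_range (iter _ T)).
- move=> x _ [u _ ux]; exists u.
  by rewrite [LHS](linearB (iter d T)) /= -ux -iterD subrr.
Qed.

End Chain.

(** * Closed ranges in real Banach spaces *)

Section RealBanach.
Context {R : realType}.

Lemma closure_normP (V : normedModType R) (A : set V) (x : V) :
  closure A x <-> forall e, 0 < e -> exists2 y, A y & `|x - y| < e.
Proof.
split=> [Ax e e0|Ax B /nbhs_ballP[e /= e0]].
  have xe : nbhs x [set y | `|x - y| < e] by apply/nbhs_normP; exists e.
  by have [y [Ay xy]] := Ax _ xe; exists y.
rewrite -ball_normE => eB; have [y Ay xy] := Ax e e0.
by exists y; split=> //; exact: eB.
Qed.

Lemma submodule_closure (V : normedModType R) (M : set V) :
  submodule M -> submodule (closure M).
Proof.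
move=> sM; split; first exact/subset_closure/sM.1.
move=> a x y /closure_normP Mx /closure_normP My; apply/closure_normP => e e0.
have a1 : 0 < `|a| + 1 by rewrite ltr_wpDl.
have [|x' Mx' xx'] := Mx (e / (`|a| + 1) / 2); first by rewrite !divr_gt0.
have [|y' My' yy'] := My (e / 2); first by rewrite divr_gt0.
exists (a *: x' + y'); first exact: sM.2.
rewrite opprD addrACA -scalerBr (le_lt_trans (ler_normD _ _)) // normrZ.
rewrite [ltRHS](splitr e) ler_ltD //.
apply: (@le_trans _ _ ((`|a| + 1) * (e / (`|a| + 1) / 2))).
  by apply: ler_pM => //; [rewrite lerDl | exact: ltW].
by rewrite [leLHS](_ : _ = e / 2) //; field; rewrite gt_eqF.
Qed.

(** Correcting x again and again leaves errors of norm at most |x| / 2^k, so the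
    corrections u_k are bounded by a geometric series and sum to some u by
    completeness of [Y]. The parts of the corrections that lie in [N] need not
    converge separately: x - A u is the limit of their partial sums, and [N] is
    closed. *)
Lemma halving_iteration (Y : completeNormedModType R) (X : normedModType R)
    (A : {linear Y -> X}) (N S : set X) (C : R) :
  0 <= C -> continuous A -> closed N -> submodule N ->
  (forall x, S x -> exists u m, [/\ `|u| <= C * `|x|, N m,
    `|x - (A u + m)| <= `|x| / 2 & S (x - (A u + m))]) ->
  forall x, S x -> exists2 u, `|u| <= 2 * C * `|x| & N (x - A u).
Proof.
move=> C0 cA cN sN approx x Sx.
have /choice[f fP] : forall z, exists um : Y * X, S z ->
    [/\ `|um.1| <= C * `|z|, N um.2, `|z - (A um.1 + um.2)| <= `|z| / 2 &
        S (z - (A um.1 + um.2))].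
  move=> z; have [Sz|nSz] := pselect (S z); last by exists (0, 0).
  by have [u [m h]] := approx z Sz; exists (u, m).
pose xs k := iter k (fun z => z - (A (f z).1 + (f z).2)) x.
pose u k := (f (xs k)).1.
have Sxs k : S (xs k) by elim: k => [//|k IHk]; have [] := fP _ IHk.
have nxs k : `|xs k| <= `|x| * 2^-1 ^+ k.
  elim: k => [|k IHk]; first by rewrite expr0 mulr1.
  have [_ _ le2 _] := fP _ (Sxs k); apply: (le_trans le2).
  by rewrite exprSr mulrA ler_wpM2r.
have half1 : `|2^-1 : R| < 1 by rewrite ger0_norm // invf_lt1 // ltr1n.
have nu k : `|u k| <= geometric (C * `|x|) 2^-1 k.
  have [le1 _ _ _] := fP _ (Sxs k); apply: (le_trans le1).
  by rewrite /= -mulrA ler_wpM2l.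
have cvg_geo := @cvg_geometric_series _ (C * `|x|) _ half1.
have cvg_nu : cvgn [normed series u].
  apply: (@series_le_cvg _ _ (geometric (C * `|x|) 2^-1)) => [k|k|k|].
  - exact: normr_ge0.
  - exact: le_trans (nu k).
  - exact: nu.
  - exact: cvgP cvg_geo.
have cvg_u := normed_cvg cvg_nu.
exists (limn (series u)).
  apply: (le_trans (lim_series_norm cvg_nu)).
  have -> : 2 * C * `|x| = limn (series (geometric (C * `|x|) 2^-1)).
    by rewrite (cvg_lim _ cvg_geo) //; field.
  apply: ler_lim => //; first exact: cvgP cvg_geo.
  by near=> k; apply: ler_sum => i _; exact: nu.
apply: (@closed_cvg _ _ \oo _ (fun k => x - A (series u k) - xs k)) => //.
  apply: nearW; elim=> [|k IHk].
    rewrite /series /= big_geq // linear0 subr0 subrr; exact: sN.1.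
  have [_ Nm _ _] := fP _ (Sxs k).
  rewrite seriesSr linearD /= -/(u k).
  have -> : x - (A (series u k) + A (u k)) - (xs k - (A (u k) + (f (xs k)).2)) =
    x - A (series u k) - xs k + (f (xs k)).2.
    rewrite !opprD !opprK -!addrA; congr (_ + (_ + _)).
    by rewrite addrCA addKr.
  exact: submoduleD.
rewrite -[X in _ --> X]subr0; apply: cvgB.
  apply: cvgB; first exact: cvg_cst.
  apply: continuous_cvg; [exact: cA | exact: cvg_u].
apply/norm_cvg0P.
apply: (@squeeze_cvgr _ _ _ _ (fun=> 0) (geometric `|x| 2^-1)).
- by near=> k; rewrite normr_ge0 nxs.
- exact: cvg_cst.
- exact: cvg_geometric.
Unshelve. all: by end_near.
Qed.

(** The open mapping theorem for the surjection [Y -> X / N] induced by [A],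
    stated without the quotient. The images of the balls of [Y] cover [X / N], so
    by Baire one of them is dense in a ball; differences of its elements
    approximate every small vector, and the iteration makes the approximation
    exact. *)
Lemma open_mapping_mod (X Y : completeNormedModType R)
    (A : {linear Y -> X}) (N : set X) :
  continuous A -> closed N -> submodule N ->
  (forall x, exists u, N (x - A u)) ->
  exists2 C, 0 <= C & forall x, exists2 u, `|u| <= C * `|x| & N (x - A u).
Proof.
move=> cA cN sN surj.
pose B (n : nat) := [set x | exists2 u, `|u| <= n%:R & N (x - A u)].
have [n ndense] : exists n, ~ dense (~` closure (B n)).
  apply/existsNP => alldense.
  have : dense (\bigcap_n ~` closure (B n)).
    apply: Baire => n; split; last exact: alldense.
    by rewrite openC; exact: closed_closure.
  move=> /(_ setT) [||z [_ zB]]; [by exists 0|exact: openT|].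
  have [u zu] := surj z.
  apply: (zB (Num.truncn `|u|).+1 I); apply: subset_closure.
  by exists u => //; rewrite ltW // truncnS_gt.
have [G [[x0 xG] GB]] := denseNE ndense.
have /nbhs_ballP[e /= e0] := open_nbhs_nbhs xG.
rewrite -ball_normE => eG.
have eB y : `|x0 - y| < e -> closure (B n) y.
  move=> /eG Gy; apply: contrapT => nBy.
  by have : (G `&` ~` closure (B n)) y by []; rewrite GB.
pose C := 4 * n%:R / e.
have C0 : 0 <= C by rewrite !mulr_ge0 // invr_ge0 ltW.
have approx x : setT x -> exists u m, [/\ `|u| <= C * `|x|, N m,
    `|x - (A u + m)| <= `|x| / 2 & setT (x - (A u + m))].
  move=> _; have [->|x_neq0] := eqVneq x 0.
    exists 0, 0; rewrite linear0 addr0 subr0 !normr0 mulr0 mul0r.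
    by split=> //; exact: sN.1.
  have nx : 0 < `|x| by rewrite normr_gt0.
  (* t *: x has norm e / 2, so x0 + t *: x and x0 lie in the ball of radius e *)
  pose t := e / (2 * `|x|).
  have t0 : 0 < t by rewrite divr_gt0 // mulr_gt0.
  have e8 : 0 < e / 8 by rewrite divr_gt0.
  have [|p [u pu Np] xp] := (closure_normP (B n) (x0 + t *: x)).1 _ _ e8.
    apply: eB; rewrite opprD addNKr normrN normrZ gtr0_norm //.
    by rewrite /t invfM !mulrA divfK ?gt_eqF // ltr_pdivrMr // ltr_pMr // ltr1n.
  have [|q [v qv Nq] xq] := (closure_normP (B n) x0).1 _ _ e8.
    by apply: eB; rewrite subrr normr0.
  have tx : `|t *: x - (p - q)| <= e / 4.
    have -> : t *: x - (p - q) = (x0 + t *: x - p) - (x0 - q).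
      by rewrite !opprD !opprK [RHS]addrACA [x0 + _]addrC addrK.
    rewrite (le_trans (ler_normB _ _)) //.
    rewrite (le_trans (lerD (ltW xp) (ltW xq))) //.
    lra.
  exists (t^-1 *: (u - v)), (t^-1 *: (p - q - A (u - v))).
  have -> : A (t^-1 *: (u - v)) + t^-1 *: (p - q - A (u - v)) = t^-1 *: (p - q).
    by rewrite linearZ -scalerDr addrC subrK.
  split=> //.
  - rewrite normrZ gtr0_norm ?invr_gt0 //.
    apply: (@le_trans _ _ (t^-1 * (n%:R + n%:R))).
      rewrite ler_wpM2l ?invr_ge0 ?(ltW t0) // (le_trans (ler_normB _ _)) //.
      exact: lerD.
    by rewrite [leLHS](_ : _ = C * `|x|) // /t /C; field; rewrite !gt_eqF.
  - apply: submoduleZ => //.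
    have -> : p - q - A (u - v) = (p - A u) - (q - A v).
      by rewrite linearB !opprD !opprK addrACA.
    exact: submoduleB.
  - rewrite -[X in X - _](scalerK (lt0r_neq0 t0)) -scalerBr normrZ.
    rewrite gtr0_norm ?invr_gt0 //.
    rewrite ler_pdivrMl // (le_trans tx) //.
    by rewrite [leRHS](_ : _ = e / 4) // /t; field; rewrite gt_eqF.
exists (2 * C); first by rewrite mulr_ge0.
by move=> x; exact: (halving_iteration C0 cA cN sN approx).
Qed.

(** For z in range A, the bounded lift u of z satisfies z - A u in range A cap N.
    A point of the closure of range A is approximated by such z within half its
    norm, which starts the iteration relative to the closed subspace
    range A cap N. *)
Lemma closed_range_mod (X Y : completeNormedModType R)
    (A : {linear Y -> X}) (N : set X) :
  continuous A -> closed N -> submodule N ->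
  (forall x, exists u, N (x - A u)) -> closed (range A `&` N) ->
  closed (range A).
Proof.
move=> cA cN sN surj cF.
have [C C0 liftA] := open_mapping_mod cA cN sN surj.
have sA := submodule_range A.
have sF : submodule (range A `&` N) by exact: submoduleI.
have scA := submodule_closure sA.
suff approx x : closure (range A) x -> exists u m, [/\ `|u| <= 2 * C * `|x|,
    (range A `&` N) m, `|x - (A u + m)| <= `|x| / 2 &
    closure (range A) (x - (A u + m))].
  have C2 : 0 <= 2 * C by rewrite mulr_ge0.
  move=> y /(halving_iteration C2 cA cF sF approx)[u _ [Ay _]].
  by rewrite -(subrK (A u) y); apply: submoduleD => //; exists u.
move=> Ax; have [->|x_neq0] := eqVneq x 0.
  exists 0, 0; rewrite linear0 addr0 subr0 !normr0 mulr0 mul0r.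
  by split=> //; [exact: sF.1 | exact: scA.1].
have nx2 : 0 < `|x| / 2 by rewrite divr_gt0 // normr_gt0.
have [z Az xz] := (closure_normP _ _).1 Ax _ nx2.
have nz : `|z| <= 2 * `|x|.
  rewrite -(subKr x z) (le_trans (ler_normB _ _)) //.
  rewrite mulr_natl mulr2n lerD2l (le_trans (ltW xz)) //.
  by rewrite ler_pdivrMr // ler_peMr // ler1n.
have [u uz Nu] := liftA z.
exists u, (z - A u).
have -> : A u + (z - A u) = z by rewrite addrC subrK.
split.
- by rewrite (le_trans uz) // -mulrA mulrCA ler_wpM2l.
- by split=> //; apply: submoduleB => //; exists u.
- exact: ltW.
- by apply: (submoduleB scA Ax); exact: subset_closure.
Qed.

Section Line.
Context {X : normedModType R} (g : X).

Definition line (a : R^o) : X := a *: g.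

Fact line_is_linear : linear line.
Proof. by move=> a b c; rewrite /line scalerDl scalerA. Qed.

HB.instance Definition _ := GRing.isLinear.Build R R^o X _ line line_is_linear.

Lemma continuous_line : continuous line.
Proof. exact: scalel_continuous. Qed.

End Line.

(** If [g] is outside [N], its distance e to [N] is positive, and the coefficient
    a of a vector a g + m of N + <g> is at most |a g + m| / e. This bound allows
    the iteration for the operator a |-> a g. *)
Lemma closed_add_line (X : normedModType R) (N : set X) (g : X) :
  closed N -> submodule N -> closed [set x | exists a, N (x - a *: g)].
Proof.
move=> cN sN; set L := [set x | _].
have [Ng|nNg] := pselect (N g).
  rewrite (_ : L = N) //; apply/seteqP; split=> [x [a Nx]|x Nx]; last first.
    by exists 0; rewrite scale0r subr0.
  by rewrite -(subrK (a *: g) x); apply: submoduleD => //; exact: submoduleZ.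
have [e e0 eg] : exists2 e, 0 < e & forall m, N m -> e <= `|g - m|.
  apply: contrapT => nex; apply/nNg/cN/closure_normP => e e0.
  apply: contrapT => nm; apply: nex; exists e => // m Nm.
  by rewrite leNgt; apply/negP => gm; apply: nm; exists m.
have coef a m : N m -> e * `|a| <= `|a *: g + m|.
  move=> Nm; have [->|a0] := eqVneq a 0; first by rewrite normr0 mulr0.
  have -> : a *: g + m = a *: (g - - a^-1 *: m).
    by rewrite scaleNr opprK scalerDr scalerA mulfV // scale1r.
  rewrite normrZ mulrC ler_wpM2l //; apply: eg; exact: submoduleZ.
have sL : submodule L by exact: (@submodule_span_mod _ _ N [:: g]).
have scL := submodule_closure sL.
suff approx x : closure L x -> exists (u : R^o) m, [/\ `|u| <= 2 / e * `|x|,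
    N m, `|x - (line g u + m)| <= `|x| / 2 & closure L (x - (line g u + m))].
  have C0 : 0 <= 2 / e by rewrite divr_ge0 // ltW.
  move=> y /(halving_iteration C0 (@continuous_line _ g) cN sN approx)[a _ Na].
  by exists a.
move=> Lx; have [->|x_neq0] := eqVneq x 0.
  exists 0, 0; rewrite linear0 addr0 subr0 !normr0 mulr0 mul0r.
  by split=> //; [exact: sN.1 | exact: scL.1].
have nx2 : 0 < `|x| / 2 by rewrite divr_gt0 // normr_gt0.
have [z [a Nz] xz] := (closure_normP _ _).1 Lx _ nx2.
have nz : `|z| <= 2 * `|x|.
  rewrite -(subKr x z) (le_trans (ler_normB _ _)) //.
  rewrite mulr_natl mulr2n lerD2l (le_trans (ltW xz)) //.
  by rewrite ler_pdivrMr // ler_peMr // ler1n.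
exists a, (z - a *: g).
have -> : line g a + (z - a *: g) = z by rewrite /line addrC subrK.
split=> //.
- rewrite mulrAC ler_pdivlMr // mulrC (le_trans _ nz) //.
  by have := coef a _ Nz; rewrite addrC subrK.
- exact: ltW.
- by apply: (submoduleB scL Lx); apply: subset_closure; exists a.
Qed.

Lemma closed_span_mod (X : normedModType R) (N : set X) (s : seq X) :
  closed N -> submodule N -> closed (span_mod N s).
Proof.
move=> cN sN; elim: s => [//|g s IHs].
by apply: closed_add_line => //; exact: submodule_span_mod.
Qed.

Lemma closed_fin_mod (X : normedModType R) (N P : set X) :
  closed N -> submodule N -> submodule P -> N `<=` P -> fin_mod P N -> closed P.
Proof.
move=> cN sN sP NP /(fin_modP _ sN) /(bounded_indep_span sN) [s Ps sub].
rewrite (_ : P = span_mod N s); first exact: closed_span_mod.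
by apply/seteqP; split=> //; exact: span_mod_sub.
Qed.

(** The set of the last hypothesis is range A + N. When [s] spans [X] modulo
    it, [N] may be replaced by the closed subspace [span_mod N s], which still
    meets range A in finite dimension, since (range A cap span_mod N s) modulo
    (range A cap N) embeds in [span_mod N s] modulo [N]. *)
Theorem closed_range_fin (X Y : completeNormedModType R)
    (A : {linear Y -> X}) (N : set X) :
  continuous A -> closed N -> submodule N ->
  fin_mod (range A `&` N) [set 0] ->
  fin_mod [set: X] [set x | exists u, N (x - A u)] ->
  closed (range A).
Proof.
move=> cA cN sN finI [s finD].
have sN' := submodule_span_mod s sN.
have sA := submodule_range A.
apply: (closed_range_mod cA (closed_span_mod (s := s) cN sN) sN').
- move=> x; have := finD x I; elim: s x {finD sN'} => [//|g s IHs] x [a].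
  by move=> /IHs[u Nu]; exists u, a; rewrite addrAC.
- apply: (@closed_fin_mod _ [set 0]).
  + exact/accessible_closed_set1/hausdorff_accessible/norm_hausdorff.
  + exact: submodule0.
  + exact: submoduleI.
  + by move=> _ ->; split; [exact: sA.1 | exact: sN'.1].
  + apply: (fin_mod_trans _ finI).
    apply: (@fin_mod_preimage _ _ _ idfun _ _ (span_mod N s) N) => //.
    * exact: submoduleI.
    * exact: submoduleI.
    * by move=> x [].
    * by move=> x [].
    * by exists s.
Qed.

End RealBanach.

(** * Complex Banach spaces as real ones *)

(** A copy of the type [X], on which scalars are restricted to the reals and the
    norm takes real values. *)
Definition realify {R : realType} (X : completeNormedModType R[i]) : Type := X.

Section Realify.
Context {R : realType} (X : completeNormedModType R[i]).
Notation Xr := (realify X).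

HB.instance Definition _ := GRing.Zmodule.on Xr.

Let scale (a : R) (x : Xr) : Xr := (a%:C *: (x : X)).

Fact realify_scaleA a b (x : Xr) : scale a (scale b x) = scale (a * b) x.
Proof. by rewrite /scale scalerA rmorphM. Qed.

Fact realify_scale1 : left_id 1 scale.
Proof. by move=> x; rewrite /scale rmorph1 scale1r. Qed.

Fact realify_scaleDr : right_distributive scale +%R.
Proof. by move=> a x y; rewrite /scale scalerDr. Qed.

Fact realify_scaleDl (x : Xr) : {morph scale^~ x : a b / a + b}.
Proof. by move=> a b; rewrite /scale rmorphD scalerDl. Qed.

HB.instance Definition _ := GRing.Zmodule_isLmodule.Build R Xr
  realify_scaleA realify_scale1 realify_scaleDr realify_scaleDl.

Let norm (x : Xr) : R := complex.Re `|x : X|.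

Lemma normC (x : X) : `|x| = (norm x)%:C.
Proof. by rewrite /norm RRe_real // ger0_real. Qed.

Fact realify_normD x y : norm (x + y) <= norm x + norm y.
Proof. by rewrite -lecR rmorphD /= -!normC ler_normD. Qed.

Fact realify_normZ (a : R) x : norm (a *: x) = `|a| * norm x.
Proof.
apply: complexI; rewrite rmorphM /= -!normC normrZ; congr (_ * _).
by rewrite normc_def /= expr0n addr0 sqrtr_sqr.
Qed.

Fact realify_norm0_eq0 x : norm x = 0 -> x = 0.
Proof. by move=> nx0; apply: (@normr0_eq0 _ X); rewrite normC nx0. Qed.

HB.instance Definition _ := Lmodule_isNormed.Build R Xr
  realify_normD realify_normZ realify_norm0_eq0.

Lemma norm_realify (x : Xr) : (`|x|)%:C = `|x : X|.
Proof. by rewrite normC. Qed.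

Lemma nbhs_realify (x : X) (B : set X) : nbhs (x : Xr) B <-> nbhs x B.
Proof.
split=> /nbhs_ballP[e /= e0]; rewrite -ball_normE => eB; apply/nbhs_ballP.
- exists e%:C; first by rewrite /= ltcR.
  rewrite -ball_normE => y /= xy; apply: eB.
  by rewrite /= -ltcR norm_realify.
- have eE : e = (complex.Re e)%:C by rewrite RRe_real // gtr0_real.
  exists (complex.Re e); first by rewrite /= -ltcR -eE.
  rewrite -ball_normE => y /= xy; apply: eB.
  by rewrite /= eE -(norm_realify (x - y)) ltcR.
Qed.

Fact realify_complete (F : set_system Xr) : ProperFilter F -> cauchy F -> cvg F.
Proof.
move=> FF /cauchy_ballP cF.
have cFX : cauchy (F : set_system X).
  apply/cauchy_ballP => e e0.
  have eE : e = (complex.Re e)%:C by rewrite RRe_real // gtr0_real.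
  have e0' : 0 < complex.Re e by rewrite -ltcR -eE.
  apply: filterS (cF _ e0') => -[x y]; rewrite -!ball_normE /= => xy.
  by rewrite eE -(norm_realify (x - y)) ltcR.
have /cvg_ex[l Fl] : cvg (F : set_system X) by exact: cauchy_cvg.
by apply/cvg_ex; exists (l : Xr) => B /nbhs_realify; exact: Fl.
Qed.

HB.instance Definition _ := Uniform_isComplete.Build Xr realify_complete.

Lemma closed_realify (B : set X) : closed (B : set Xr) -> closed B.
Proof. by move=> cB x Bx; apply: cB => D /nbhs_realify; exact: Bx. Qed.

Lemma realify_closed (B : set X) : closed B -> closed (B : set Xr).
Proof. by move=> cB x Bx; apply: cB => D /nbhs_realify; exact: Bx. Qed.

Lemma submodule_realify (M : set X) : submodule M -> submodule (M : set Xr).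
Proof. by move=> [M0 sM]; split=> // a x y; exact: (sM a%:C). Qed.

(** A complex line is spanned over the reals by g and i g. *)
Lemma fin_mod_realify (P Q : set X) :
  fin_mod P Q -> fin_mod (P : set Xr) (Q : set Xr).
Proof.
move=> [s Ps]; exists (flatten [seq [:: g; 'i *: g] | g <- s]) => x /Ps.
elim: s x {Ps} => [//|g s IHs] x [a /IHs as_] /=.
exists (complex.Re a), (complex.Im a).
rewrite [a in a *: g]complexE scalerDl opprD addrA ['i * _]mulrC in as_.
by rewrite -scalerA in as_.
Qed.

End Realify.

Section RealifyLinear.
Context {R : realType} {X : completeNormedModType R[i]} (A : {linear X -> X}).

Definition realify_fun (x : realify X) : realify X := A x.

Fact realify_fun_linear : linear realify_fun.
Proof. by move=> a x y; exact: (linearP A a%:C). Qed.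

HB.instance Definition _ :=
  GRing.isLinear.Build R (realify X) (realify X) _ realify_fun
    realify_fun_linear.

Lemma continuous_realify_fun : continuous A -> continuous realify_fun.
Proof.
move=> cA x B /nbhs_realify Bx; apply/nbhs_realify; exact: (cA x).
Qed.

End RealifyLinear.

Lemma closed_range_of_fin_mod (R : realType) (X : completeNormedModType R[i])
    (A : {linear X -> X}) :
  continuous A ->
  fin_mod (range A `&` [set x | A x = 0]) [set 0] ->
  fin_mod [set: X] [set x | exists u, A (x - A u) = 0] ->
  closed (range A).
Proof.
move=> cA /fin_mod_realify finI /fin_mod_realify finD; apply: closed_realify.
apply: (closed_range_fin (continuous_realify_fun cA) _ _ finI finD).
  apply: realify_closed.
  apply: (@preimage_closed _ _ A [set 0]); first by move=> x _; exact: cA.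
  exact/accessible_closed_set1/hausdorff_accessible/norm_hausdorff.
exact/submodule_realify/submodule_ker.
Qed.

(** * Closed ranges of iterates and the essential degree *)

Section Iterates.
Context {R : realType} {X : completeNormedModType R[i]} (T : {linear X -> X}).

Lemma continuous_iter (n : nat) : continuous T -> continuous (iter n T).
Proof.
move=> cT; elim: n => [|n IHn] x; first exact: cvg_id.
by apply: continuous_comp; [exact: IHn | exact: cT].
Qed.

Lemma closed_range_iter (d : nat) : continuous T ->
  fin_mod (ker_range T d) [set 0] ->
  fin_mod (range (iter d T)) (range (iter d.+1 T)) ->
  closed (range (iter d T)).
Proof.
move=> cT ad bd; apply: closed_range_of_fin_mod.
- exact: continuous_iter.
- exact: fin_range_ker_iter.
- exact: fin_codim_range_ker.
Qed.

Lemma bounded_restr (n : nat) : bounded_op T -> bounded_op (restr T n).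
Proof.
move=> /linear_boundedP bT; apply/linear_boundedP.
by apply: filterS bT => r bT x; exact: bT.
Qed.

Lemma closed_range_restr (n : nat) :
  closed (range (iter n.+1 T)) -> closed (range (restr T n)).
Proof.
move=> cR z Rz; apply/range_restr/cR => B /nbhs_ballP[e /= e0].
rewrite -ball_normE => eB.
have ze : nbhs z (ball z e) by exact: nbhsx_ballx.
have [y [/range_restr Ry]] := Rz _ ze.
by rewrite -ball_normE => zy; exists (rval y); split => //; exact: eB.
Qed.

End Iterates.

Lemma essential_degreeE (R : realType) (K : numFieldType) (V : lmodType K)
    (T : {linear V -> V}) (d : nat) :
  (Order.min (alpha R (restr T d)) (beta R (restr T d)) < +oo)%E ->
  (forall n, (Order.min (alpha R (restr T n)) (beta R (restr T n)) < +oo)%E ->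
    (d <= n)%N) ->
  essential_degree R T = (d%:R)%:E.
Proof.
move=> dfin dmin; apply/eqP; rewrite eq_le; apply/andP; split.
  by apply: ereal_inf_lbound; exists d.
by apply: le_ereal_inf_tmp => _ [n /dmin dn <-]; rewrite lee_fin ler_nat.
Qed.

Theorem theorem2p10 (R : realType) (X : completeNormedModType R[i])
  (T : {linear X -> X})
  (X_infinite_dim : algdim R [set: X] = +oo%E)
  (T_bounded : bounded_op T)
  (T_finite : exists n m : nat,
    (alpha R (restr T n) < +oo)%E /\ (beta R (restr T m) < +oo)%E) :
  exists d : nat,
    [/\ essential_degree R T = (d%:R)%:E,
        closed (range (iter d T)) &
        fredholm R (restr T d)].
Proof.
have [n [m [/alpha_restr_fin an /beta_restr_fin bm]]] := T_finite.
pose degs d := (Order.min (alpha R (restr T d)) (beta R (restr T d)) < +oo)%E.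
have degsP d : degs d <-> (fin_mod (ker_range T d) [set 0] \/
    fin_mod (range (iter d T)) (range (iter d.+1 T))).
  rewrite /degs gt_min -(alpha_restr_fin T R) -(beta_restr_fin T R).
  by split=> /orP.
have ex_deg : exists d, degs d by exists n; apply/degsP; left.
case: (ex_minnP ex_deg) => d degd dmin; exists d.
have [ad bd] := fin_alpha_beta an bm ((degsP d).1 degd).
have cT : continuous T by exact: bounded_linear_continuous.
split; [exact: essential_degreeE | exact: closed_range_iter | split].
- exact: bounded_restr.
- apply/closed_range_restr/closed_range_iter => //; first exact: fin_alphaS.
  exact: fin_betaS.
- exact/alpha_restr_fin.
- exact/beta_restr_fin.
Qed.
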